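(* Let $\{C,C'\}$ be a 1-completable pair of maximal caps in $AG(4,3)$, and let $C'=C_1\cup R_1$ be the decomposition of $C'$ into two disjoint demicaps with $\Phi(\{C_1,R_1\})=C$. The demicap $C_1$ lies in exactly six maximal caps; let $R_1,\dots,R_6$ be the complements of $C_1$ in these six maximal caps. Likewise $R_1$ lies in exactly six maximal caps; let $C_1,\dots,C_6$ be the complements of $R_1$ in them. Then for all $1\le i,j\le 6$, $R_i\cup C_j$ is a maximal cap, and $\{R_i\cup C_j: 1\le i,j\le 6\}$ is exactly the set of $36$ maximal caps $K$ such that $\{C,K\}$ is a 1-completable pair.
   Context: $AG(4,3)$ is the affine space $\mathbb{F}_3^4$; a line is a set of three distinct points $\{x,y,z\}$ with $x+y+z=0$. A cap is a set of points containing no line; a maximal cap is a cap of largest possible size (in $AG(4,3)$ this size is $20$); every maximal cap has a unique anchor point $a\notin C$ such that $C$ is a union of pairs $\{b,c\}$ with $\{a,b,c\}$ a line. A hyperplane is a $3$-dimensional affine subspace; co-hyperplanar means contained in a common hyperplane. For a point $a$, an $a$-line is a pair $\{b,c\}$ with $\{a,b,c\}$ a line. A demicap with anchor point $a$ is a cap consisting of the $10$ points of five $a$-lines such that no four of these five $a$-lines are co-hyperplanar. For a set $S$ and $p\notin S$, $p$ completes a line with a pair of points of $S$ if there are distinct $x,y\in S$ with $\{p,x,y\}$ a line; the number of lines $p$ completes is the number of such unordered pairs. A partition (of the relevant kind) is a partition of $AG(4,3)$ into a singleton $\{a\}$ and four pairwise disjoint maximal caps each having anchor point $a$; two disjoint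 maximal caps form a $k$-completable pair if they occur together in exactly $k$ such partitions. For a maximal cap $K$ with anchor $a$ and a decomposition $K=E\cup E'$ into two disjoint demicaps, $\Phi(\{E,E'\})$ denotes the set of points $p\notin K\cup\{a\}$ that complete exactly one line with a pair of points of $E$ and exactly one line with a pair of points of $E'$. *)

(* Defs.v *)
From HB Require Import structures.
From mathcomp Require Import all_boot all_order all_algebra.
Set Implicit Arguments. Unset Strict Implicit. Unset Printing Implicit Defensive.
Import GRing.Theory.
Local Open Scope ring_scope.

Definition pt : finType := 'rV['F_3]_4.

Definition is_line (x y z : pt) : bool :=
  [&& x != y, y != z, x != z & x + y + z == 0].

Definition cap (S : {set pt}) : bool :=
  [forall x in S, forall y in S, forall z in S, ~~ is_line x y z].

Definition maxcap (S : {set pt}) : bool :=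
  cap S && [forall T : {set pt}, cap T ==> (#|T| <= #|S|)%N].

(* a is an anchor of C: a \notin C and C is a union of a-lines {b,c}
   (i.e. pairs with {a,b,c} a line) *)
Definition anchor (a : pt) (C : {set pt}) : bool :=
  (a \notin C) && [forall b in C, exists c in C, is_line a b c].

Definition hyperplane (H : {set pt}) : Prop :=
  exists (f : pt) (c : 'F_3), f != 0 /\
    H = [set x : pt | \sum_(i < 4) f 0 i * x 0 i == c].

Definition cohyperplanar (S : {set pt}) : Prop :=
  exists H, hyperplane H /\ S \subset H.

(* demicap with anchor a: a cap consisting of the 10 points of five a-lines,
   such that no four of these five a-lines are co-hyperplanar. A union of four
   of the a-lines of D is exactly an 8-element subset of D that is itself a
   union of a-lines. *)
Definition demicap_with (a : pt) (D : {set pt}) : Prop :=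
  [/\ cap D, anchor a D, #|D| = 10%N &
      forall S : {set pt}, S \subset D -> anchor a S -> #|S| = 8%N ->
        ~ cohyperplanar S].

Definition demicap (D : {set pt}) : Prop := exists a, demicap_with a D.

Definition is_partition (P : {set {set pt}}) : bool :=
  [exists a : pt,
    [&& [set a] \in P, #|P| == 5%N, partition P [set: pt] &
        [forall K in P, (K != [set a]) ==> (maxcap K && anchor a K)]]].

Definition completable (k : nat) (C K : {set pt}) : bool :=
  [&& maxcap C, maxcap K, [disjoint C & K] &
      #|[set P | is_partition P && (C \in P) && (K \in P)]| == k].

Definition ncompl (p : pt) (S : {set pt}) : nat :=
  #|[set U : {set pt} | [exists x in S, exists y in S,
        [&& x != y, is_line p x y & U == [set x; y]]]]|.

(* Phi({E,E'}) for a maximal cap K = E :|: E' with anchor a *)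
Definition Phi (a : pt) (E E' : {set pt}) : {set pt} :=
  [set p : pt | [&& p \notin (E :|: E' :|: [set a]),
                    ncompl p E == 1%N & ncompl p E' == 1%N]].

(* Main.v *)
(* Translate the anchor of the demicap C1 to the origin: its five opposite pairs are
   then {v, -v} for a projective frame of PG(3,3), so after a linear change of
   coordinates C1 is {±e1, ..., ±e4, ±(1,1,1,1)}. A search shows that this demicap lies
   in exactly six 20-caps; the linear map permuting the frame as (v0 v1 v2)(v3 v4)
   permutes the six complements cyclically, so R1 may be taken to be any one of them,
   and then C = Phi is determined. All blocks of a partition containing C are
   symmetric about the origin, hence such a partition is a colouring of the 30
   remaining points of PG(3,3) by three caps. There are 216 such colourings; K is
   1-completable with C exactly when it is a block of exactly one of them, and these K
   are the 36 unions. Since |C'| = 20, the maximal caps are the caps with 20 points,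
   so no upper bound on the size of caps has to be proved. *)

Require Import Defs.
From HB Require Import structures.
From mathcomp Require Import all_boot all_order all_algebra.
Set Implicit Arguments. Unset Strict Implicit. Unset Printing Implicit Defensive.
Import GRing.Theory.

(** * Points of AG(4,3) as codes *)

Inductive tri := t0 | t1 | t2.

Definition tri_eqb (a b : tri) : bool :=
  match a, b with t0, t0 | t1, t1 | t2, t2 => true | _, _ => false end.

Lemma tri_eqP : Equality.axiom tri_eqb.
Proof. by case; case; constructor. Qed.

HB.instance Definition _ := hasDecEq.Build tri tri_eqP.

Definition topp (a : tri) := match a with t0 => t0 | t1 => t2 | t2 => t1 end.

Definition tadd (a b : tri) :=
  match a, b with
  | t0, c | c, t0 => c
  | t1, t1 => t2 | t2, t2 => t1
  | _, _ => t0
  end.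

Inductive code := Code of tri & tri & tri & tri.

(* Nested conditionals instead of [&&], which [vm_compute] evaluates eagerly. *)
Definition code_eqb (x y : code) : bool :=
  let: Code a b c d := x in let: Code a' b' c' d' := y in
  if tri_eqb a a' then
    if tri_eqb b b' then if tri_eqb c c' then tri_eqb d d' else false else false
  else false.

Lemma code_eqP : Equality.axiom code_eqb.
Proof.
case=> a b c d [a' b' c' d'] /=.
case: (tri_eqP a a') => [->|na]; last by constructor; case.
case: (tri_eqP b b') => [->|nb]; last by constructor; case.
case: (tri_eqP c c') => [->|nc]; last by constructor; case.
by case: (tri_eqP d d') => [->|nd]; constructor => //; case.
Qed.

HB.instance Definition _ := hasDecEq.Build code code_eqP.

Definition cadd (x y : code) :=
  let: Code a b c d := x in let: Code a' b' c' d' := y in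
  Code (tadd a a') (tadd b b') (tadd c c') (tadd d d').

Definition copp (x : code) :=
  let: Code a b c d := x in Code (topp a) (topp b) (topp c) (topp d).

Definition third (x y : code) := copp (cadd x y).

Definition zsum (x y z : code) : bool :=
  let: Code a b c d := x in let: Code a' b' c' d' := y in
  let: Code a'' b'' c'' d'' := z in
  if tri_eqb (tadd a a') (topp a'') then
    if tri_eqb (tadd b b') (topp b'') then
      if tri_eqb (tadd c c') (topp c'') then tri_eqb (tadd d d') (topp d'')
      else false
    else false
  else false.

Definition tris := [:: t0; t1; t2].

Definition codes : seq code :=
  flatten [seq flatten [seq flatten [seq [seq Code a b c d | d <- tris]
    | c <- tris] | b <- tris] | a <- tris].

Definition origin := Code t0 t0 t0 t0.

Fixpoint memc (x : code) (l : seq code) : bool :=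
  if l is y :: l' then if code_eqb x y then true else memc x l' else false.

(** Elements are listed in the fixed order of [codes], so equal sets of points become equal lists
    and sets can be compared by computation. *)
Definition nf (l : seq code) := [seq x <- codes | memc x l].

Fixpoint pair_free (p : code) (l : seq code) : bool :=
  if l is q :: l' then
    if all (fun r => ~~ zsum p q r) l' then pair_free p l' else false
  else true.

Fixpoint capb (l : seq code) : bool :=
  if l is p :: l' then if pair_free p l' then capb l' else false else true.

(* The caps [s ++ acc] with [s] a subsequence of [c] of size [n]; [k] is fuel. *)
Fixpoint ext (k n : nat) (acc c : seq code) : seq (seq code) :=
  match n, k, c with
  | 0, _, _ => [:: acc]
  | n'.+1, k'.+1, p :: c' =>
      if size c' < n' then [::] else
      ext k' n' (p :: acc) [seq q <- c' | all (fun r => ~~ zsum p r q) acc]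
      ++ ext k' n acc c'
  | _, _, _ => [::]
  end.

Definition free_of (D : seq code) :=
  [seq x <- codes | ~~ memc x D && pair_free x D].

Definition extensions (D : seq code) :=
  [seq nf K | K <- ext 81 10 D (free_of D)].

(** * The standard pair of demicaps and its cap *)

Definition frame : seq code :=
  let b := [:: Code t1 t0 t0 t0; Code t0 t1 t0 t0; Code t0 t0 t1 t0;
               Code t0 t0 t0 t1; Code t1 t1 t1 t1] in
  b ++ [seq copp x | x <- b].

(** One of the six complements of [frame] in the maximal caps over it; [rests_frame_rot] shows that
    the choice is immaterial. *)
Definition frame' : seq code :=
  let b := [:: Code t0 t1 t1 t2; Code t1 t0 t2 t1; Code t1 t1 t2 t2;
               Code t1 t2 t0 t2; Code t1 t2 t1 t0] in
  b ++ [seq copp x | x <- b].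

(** The search is run once and its result stored as a literal list, which the later computations
    reuse. *)
Definition frame_caps := Eval vm_compute in extensions frame.

Definition frame'_caps := Eval vm_compute in extensions frame'.

Lemma frame_capsE : extensions frame = frame_caps.
Proof. by vm_compute. Qed.

Lemma frame'_capsE : extensions frame' = frame'_caps.
Proof. by vm_compute. Qed.

(** For [t] outside [l], a line through [t] and two points of [l] is counted from both of them, so
    the count 2 means a single line. *)
Definition on_one_line (t : code) (l : seq code) : bool :=
  size [seq x <- l | memc (third t x) l] == 2.

Definition in_phi (t : code) : bool :=
  [&& ~~ memc t (origin :: frame ++ frame'), on_one_line t frame & on_one_line t frame'].

Definition phi_cap : seq code := Eval vm_compute in filter in_phi codes.

Lemma phi_capE : filter in_phi codes = phi_cap.
Proof. by vm_compute. Qed.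

(* Collinearity of [±p], [±r], [±q] in PG(3,3). *)
Definition bad (p r q : code) : bool :=
  if zsum p r q then true else if zsum p r (copp q) then true
  else if zsum p (copp r) q then true else zsum (copp p) r q.

(* A point together with the colours it can still receive. *)
Definition pending := (code * seq tri)%type.

Fixpoint pick_min (x : pending) (l : seq pending) : pending * seq pending :=
  if l is y :: l' then
    if size y.2 < size x.2 then let: (m, r) := pick_min y l' in (m, x :: r)
    else let: (m, r) := pick_min x l' in (m, y :: r)
  else (x, [::]).

(** Only lines through the newly coloured [p] are tested: lines through two earlier points were
    tested when the later of them was coloured. *)
Definition restrict (p : code) (i : tri) (asg : seq (code * tri)) (qd : pending)
    : pending :=
  (qd.1, [seq j <- qd.2 | if tri_eqb i j then
            all (fun rj => if tri_eqb i rj.2 then ~~ bad p rj.1 qd.1 else true) asg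
            else true]).

(* Branches on a point with the fewest remaining colours; [k] is fuel. *)
Fixpoint colour (k : nat) (asg : seq (code * tri)) (pend : seq pending) :=
  match k, pend with
  | _, [::] => [:: asg]
  | 0, _ => [::]
  | k'.+1, x :: l =>
      let: ((p, d), rest) := pick_min x l in
      flatten [seq colour k' ((p, i) :: asg) (map (restrict p i asg) rest) | i <- d]
  end.

(* Selects one vector from each pair [±x]. *)
Definition positive (x : code) : bool :=
  match x with
  | Code t1 _ _ _ | Code t0 t1 _ _ | Code t0 t0 t1 _ | Code t0 t0 t0 t1 => true
  | _ => false
  end.

(** One vector for each of the 30 points of PG(3,3) outside the cap. *)
Definition reps := [seq x <- codes | positive x && ~~ memc x phi_cap].

(* Collinear points of PG(3,3), so they never lie in the same block. *)
Definition q0 := Code t0 t0 t0 t1.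
Definition q1 := Code t0 t0 t1 t0.
Definition q2 := Code t0 t0 t1 t2.

Definition start (d0 d1 d2 : seq tri) : seq pending :=
  [:: (q0, d0); (q1, d1); (q2, d2)]
  ++ [seq (x, tris) | x <- reps & ~~ memc x [:: q0; q1; q2]].

Fixpoint has_colour (x : code) (i : tri) (asg : seq (code * tri)) : bool :=
  if asg is (y, j) :: asg' then
    if tri_eqb i j then if code_eqb x y then true else has_colour x i asg'
    else has_colour x i asg'
  else false.

Definition block (asg : seq (code * tri)) (i : tri) : seq code :=
  [seq x <- codes | if has_colour x i asg then true else has_colour (copp x) i asg].

Definition blocks (asg : seq (code * tri)) := [seq block asg i | i <- tris].

(* The colours are named by [q0] and the first of [q1], [q2] of another colour. *)
Definition colourings :=
  colour 81 [::] (start [:: t0] [:: t0] [:: t1])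
  ++ colour 81 [::] (start [:: t0] [:: t1] tris).

Definition partitions : seq (seq (seq code)) :=
  Eval vm_compute in [seq blocks a | a <- colourings].

Lemma partitionsE : [seq blocks a | a <- colourings] = partitions.
Proof. by vm_compute. Qed.

Definition all_blocks (s : seq (seq code)) := [:: origin] :: phi_cap :: s.

Definition valid_partition (s : seq (seq code)) : bool :=
  if all (fun l => if size l == 20 then capb l else false) s
  then all (fun t => count (memc t) (all_blocks s) == 1) codes else false.

(** That each colouring found gives a partition into caps is checked on the output of the search;
    what has to be proved about the search is its completeness. *)
Lemma partitions_valid : all valid_partition partitions.
Proof. by vm_compute. Qed.

(** * The 36 unions and the partitions through them *)

Definition meml (l : seq code) (s : seq (seq code)) : bool := has (eqseq l) s.

Definition rests (D : seq code) (L : seq (seq code)) :=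
  [seq [seq x <- K | ~~ memc x D] | K <- L].

Definition products : seq (seq code) := Eval vm_compute in
  [seq nf (r ++ d) | r <- rests frame frame_caps, d <- rests frame' frame'_caps].

Lemma productsE :
  [seq nf (r ++ d) | r <- rests frame frame_caps, d <- rests frame' frame'_caps]
  = products.
Proof. by vm_compute. Qed.

Definition occurs_once (l : seq code) : bool :=
  if [seq s <- partitions | meml l s] is [:: _] then true else false.

(** Two entries count as different partitions only when a block of the first is missing from the
    second, so repetitions in [partitions] cannot mislead the test. *)
Definition occurs_twice (l : seq code) : bool :=
  if [seq s <- partitions | meml l s] is s :: s' :: _ then
    ~~ all (fun k => meml k s') s else false.

Lemma products_once : all occurs_once products.
Proof. by vm_compute. Qed.

(** With [products_once] this separates the blocks lying in a single partition from all other
    blocks. *)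
Lemma non_products_twice :
  all (all (fun l => if meml l products then true else occurs_twice l)) partitions.
Proof. by vm_compute. Qed.

(** * Completeness of the searches *)

Lemma memcE x l : memc x l = (x \in l).
Proof. by elim: l => //= y l IHl; rewrite inE -IHl -[code_eqb x y]/(x == y); case: eqP. Qed.

Lemma codes_uniq : uniq codes. Proof. by vm_compute. Qed.

Lemma mem_codes x : x \in codes.
Proof. by rewrite -memcE; case: x; do 4![case]. Qed.

Lemma mem_nf l : nf l =i l.
Proof. by move=> x; rewrite mem_filter memcE mem_codes andbT. Qed.

Lemma nf_eq l l' : l =i l' -> nf l = nf l'.
Proof. by move=> e; apply: eq_filter => x; rewrite !memcE e. Qed.

Lemma nf_filter P : nf (filter P codes) = filter P codes.
Proof. by apply: eq_filter => x; rewrite memcE mem_filter mem_codes andbT. Qed.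

Lemma nf_nf l : nf (nf l) = nf l. Proof. exact: nf_filter. Qed.

Lemma nf_uniq l : uniq (nf l). Proof. exact/filter_uniq/codes_uniq. Qed.

Lemma coppK : involutive copp.
Proof. by case; do 4![case]. Qed.

Lemma zsumE x y z : zsum x y z = (z == third x y).
Proof.
case: x y z => a b c d [a' b' c' d'] [a'' b'' c'' d''].
rewrite /zsum /third /= -[_ == _]/(code_eqb _ _) /=.
have e u v w : tri_eqb (tadd u v) (topp w) = tri_eqb w (topp (tadd u v)).
  by case: u v w => [] [] [].
by rewrite !e.
Qed.

Lemma zsumC x y z : zsum x y z = zsum y x z.
Proof.
case: x y z => a b c d [a' b' c' d'] [a'' b'' c'' d''] /=.
have e u v : tadd u v = tadd v u by case: u v => [] [].
by rewrite (e a) (e b) (e c) (e d).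
Qed.

Lemma zsum_rot x y z : zsum x y z = zsum y z x.
Proof.
case: x y z => a b c d [a' b' c' d'] [a'' b'' c'' d''] /=.
have e u v w : tri_eqb (tadd u v) (topp w) = tri_eqb (tadd v w) (topp u).
  by case: u v w => [] [] [].
by rewrite !(e a) !(e b) !(e c) !(e d).
Qed.

Lemma zsumCr x y z : zsum x y z = zsum x z y.
Proof. by rewrite zsumC zsum_rot. Qed.

Lemma third_fix x y : (third x y == y) = (x == y).
Proof.
case: x y => a b c d [a' b' c' d'].
rewrite -2![_ == _]/(code_eqb _ _) /=.
have e u v : tri_eqb (topp (tadd u v)) v = tri_eqb u v by case: u v => [] [].
by rewrite !e.
Qed.

Lemma zsum_neq x y z : zsum x y z -> x != y -> y != z.
Proof. by rewrite zsumE => /eqP->; rewrite (eq_sym y) third_fix. Qed.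

(** Asking for [p != q] suffices: if two of three points with sum zero differ, all three are
    distinct ([zsum_neq]). *)
Definition cap_seq (l : seq code) :=
  forall p q r, p \in l -> q \in l -> r \in l -> p != q -> ~~ zsum p q r.

Lemma pair_freeP p l : uniq l ->
  reflect (forall q r, q \in l -> r \in l -> q != r -> ~~ zsum p q r) (pair_free p l).
Proof.
elim: l => [|q l IHl] /= => [_|/andP[nq /IHl{}IHl]]; first by constructor.
case: allP => [Hq|nH]; last first.
  constructor=> H; case: nH => r lr; apply: H; rewrite ?inE ?eqxx ?lr ?orbT //.
  by apply: contraNneq nq => ->.
apply: (iffP IHl) => H.
  move=> x y; rewrite !inE => /predU1P[->|lx] /predU1P[->|ly]; rewrite ?eqxx //.
  - by move=> _; apply: Hq.
  - by move=> _; rewrite zsumCr; apply: Hq.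
  - exact: H.
by move=> x y lx ly; apply: H; rewrite inE ?lx ?ly orbT.
Qed.

Lemma capbP l : uniq l -> reflect (cap_seq l) (capb l).
Proof.
elim: l => [|p l IHl] /= => [_|/andP[np ul]]; first by constructor.
case: pair_freeP => // [Hp|nH]; last first.
  constructor=> H; case: nH => q r lq lr _; apply: H; rewrite ?inE ?eqxx ?lq ?lr ?orbT //.
  by apply: contraNneq np => ->.
apply: (iffP (IHl ul)) => H; last first.
  by move=> x y z lx ly lz; apply: H; rewrite inE ?lx ?ly ?lz orbT.
move=> x y z lx ly lz nxy; apply/negP => Z.
have nyz := zsum_neq Z nxy.
have nzx : z != x by apply: (@zsum_neq y) nyz; rewrite -zsum_rot.
(* If the line passes through the head [p], it is rotated until [p] comes first and [pair_free]
   applies; otherwise it lies in [l]. *)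
move: lx ly lz; rewrite !inE.
case/predU1P=> [ex|lx]; [|case/predU1P=> [ey|ly]; [|case/predU1P=> [ez|lz]]].
- subst x; rewrite !(eq_sym _ p) (negPf nxy) eq_sym (negPf nzx) /= => ly lz.
  by have := Hp _ _ ly lz nyz; rewrite Z.
- subst y; rewrite (negPf (_ : z != p)) 1?eq_sym //= => lz.
  by have := Hp _ _ lz lx nzx; rewrite -zsum_rot Z.
- subst z; have := Hp _ _ lx ly nxy; by rewrite zsum_rot Z.
- by have := H _ _ _ lx ly lz nxy; rewrite Z.
Qed.

Lemma cap_seq_eq l l' : l =i l' -> cap_seq l -> cap_seq l'.
Proof. by move=> e H p q r; rewrite -!e; apply: H. Qed.

(** The search is followed along the branches dictated by [s]: take [p] if [s] starts with it, skip
    it otherwise. The size test never cuts this path, as the rest of [s] must still fit into the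
    remaining candidates. *)
Lemma ext_complete k n acc c s : size c <= k -> subseq s c -> size s = n ->
    uniq (s ++ acc) -> cap_seq (s ++ acc) ->
  exists2 r, r \in ext k n acc c & r =i s ++ acc.
Proof.
elim: k n acc c s => [|k IHk] [|n] acc c s.
- move=> _ _ /size0nil-> _ _; exists acc => //=; exact: mem_head.
- by case: c => // _; rewrite subseq0 => /eqP->.
- move=> _ _ /size0nil-> _ _; exists acc => //=; exact: mem_head.
case: c => [|p c]; first by rewrite subseq0 => _ /eqP->.
rewrite /= ltnS => szc.
case: s => // q s; case: eqP => [->{q}|_] sub [szs] u H.
  have := size_subseq sub; rewrite szs leqNgt => /negPf->.
  have szc' : size [seq q <- c | all (fun r => ~~ zsum p r q) acc] <= k.
    by rewrite size_filter (leq_trans (count_size _ _)).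
  have eqi : p :: s ++ acc =i s ++ p :: acc.
    by move=> x; rewrite !(inE, mem_cat) orbCA.
  have [||||r r_in er] := IHk n (p :: acc) _ s szc' => //.
  (* The filter removes no point of [s], because [p :: s ++ acc] contains no line. *)
  - suff -> : s = [seq q <- s | all (fun r => ~~ zsum p r q) acc].
      rewrite subseq_filter (subseq_trans _ sub) ?filter_subseq // andbT.
      by apply/allP=> x; rewrite mem_filter => /andP[].
    apply/esym/all_filterP/allP=> x sx; apply/allP=> r ar; apply: H.
    + exact: mem_head.
    + by rewrite inE mem_cat ar !orbT.
    + by rewrite inE mem_cat sx !orbT.
    + by move: u => /= /andP[+ _]; rewrite mem_cat negb_or => /andP[_]; apply: contraNneq => ->.
  - by rewrite -cat1s uniq_catCA.
  - exact: cap_seq_eq H.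
  by exists r; [rewrite mem_cat r_in | move=> x; rewrite er -eqi].
have szs' : size (q :: s) = n.+1 by rewrite /= szs.
have := size_subseq sub; rewrite szs' => lt_n_c.
rewrite ltnNge (ltnW lt_n_c) /=.
have [r r_in er] := IHk n.+1 acc c _ szc sub szs' u H.
by exists r => //; rewrite mem_cat r_in orbT.
Qed.

Lemma extensions_complete D K : uniq D -> size D = 10 -> size (nf K) = 20 ->
  {subset D <= K} -> cap_seq K -> nf K \in extensions D.
Proof.
move=> uD szD szK DK capK.
(* A point of [K] outside [D] completes no line with two points of [D], so it survives in
   [free_of D]. *)
pose s := [seq x <- free_of D | x \in K].
have sE x : (x \in s) = (x \in K) && (x \notin D).
  rewrite !mem_filter mem_codes memcE andbT; case Kx: (x \in K) => //=.
  case Dx: (x \in D) => //=; apply/pair_freeP=> // q r Dq Dr nqr.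
  rewrite zsum_rot; exact: capK (DK _ Dq) (DK _ Dr) Kx nqr.
have eK : s ++ D =i K.
  move=> x; rewrite mem_cat sE; case Dx: (x \in D); first by rewrite orbT DK.
  by rewrite orbF andbT.
have us : uniq s by rewrite !filter_uniq ?codes_uniq.
have u : uniq (s ++ D).
  rewrite cat_uniq us uD andbT; apply/hasPn=> x Dx; by rewrite /= sE Dx andbF.
have szs : size s = 10.
  have : perm_eq (s ++ D) (nf K).
    by apply: uniq_perm => //; [exact: nf_uniq | move=> x; rewrite eK mem_nf].
  by move/perm_size; rewrite size_cat szD szK => /(congr1 (subn^~ 10)); rewrite addnK.
(* There are 81 points in all, so the fuel given to [ext] suffices. *)
have szf : size (free_of D) <= 81.
  by rewrite size_filter (leq_trans (count_size _ _)).
have [|r r_in er] := ext_complete szf (filter_subseq _ _) szs u.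
  by apply: cap_seq_eq capK => x; rewrite eK.
rewrite /extensions; apply/mapP; exists r => //; apply: nf_eq => x; by rewrite er eK.
Qed.

Lemma extensions_nf D K : K \in extensions D -> nf K = K.
Proof. by rewrite /extensions => /mapP[L _ ->]; rewrite nf_nf. Qed.

(** * Completeness of the colouring search *)

Lemma pick_min_perm x l m r : pick_min x l = (m, r) -> perm_eq (m :: r) (x :: l).
Proof.
elim: l x m r => [|y l IHl] x m r /=; first by case=> <- <-.
case: ifP => _.
  case E: (pick_min y l) => [m' r'] [<- <-].
  rewrite -[m' :: x :: r']/([:: m'] ++ [:: x] ++ r') perm_catCA /= perm_cons; exact: IHl.
case E: (pick_min x l) => [m' r'] [<- <-].
rewrite -[m' :: y :: r']/([:: m'] ++ [:: y] ++ r') -[x :: y :: l]/([:: x] ++ [:: y] ++ l).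
by rewrite perm_catCA perm_sym perm_catCA /= perm_cons perm_sym; apply: IHl.
Qed.

(** For any admissible colouring [chi], the branch giving each selected point its colour under [chi]
    survives. The invariant is that the assigned colours agree with [chi] and that every pending
    point still has its [chi]-colour available. *)
Lemma colour_complete (chi : code -> tri) (U : seq code) : uniq U ->
    (forall p q r, p \in U -> q \in U -> r \in U -> p != q -> q != r ->
       p != r -> chi q = chi p -> chi r = chi p -> ~~ bad p q r) ->
  forall k asg pend, size pend <= k ->
    all (fun a => a.2 == chi a.1) asg -> all (fun qd => chi qd.1 \in qd.2) pend ->
    perm_eq (map fst asg ++ map fst pend) U ->
  exists2 a, a \in colour k asg pend &
    all (fun a => a.2 == chi a.1) a && perm_eq (map fst a) U.
Proof.
move=> uU capU; elim=> [|k IHk] asg [|x l] //=.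
- by rewrite cats0 => _ okA _ pU; exists asg; rewrite ?mem_head ?okA.
- by rewrite cats0 => _ okA _ pU; exists asg; rewrite ?mem_head ?okA.
rewrite ltnS => szl okA okP pU.
case E: (pick_min x l) => [[p d] r].
have pr := pick_min_perm E.
have /=/andP[dp okr] : all (fun qd : pending => chi qd.1 \in qd.2) ((p, d) :: r).
  by rewrite (perm_all _ pr).
have {}pU : perm_eq (p :: map fst asg ++ map fst r) U.
  apply: perm_trans pU; rewrite -cat1s perm_catCA perm_cat2l.
  exact: (perm_map fst pr).
have uA : uniq (p :: map fst asg ++ map fst r) by rewrite (perm_uniq pU).
have mU y : (y \in U) = (y \in p :: map fst asg ++ map fst r) by rewrite (perm_mem pU).
have rE : map fst (map (restrict p (chi p) asg) r) = map fst r by rewrite -map_comp.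
have [||||a a_in Ha] := IHk ((p, chi p) :: asg) (map (restrict p (chi p) asg) r).
- by move: (perm_size pr) => /= [szr]; rewrite size_map szr.
- by rewrite /= eqxx.
- rewrite all_map; apply/allP=> -[q e] rq /=.
  have /= eq := allP okr _ rq; rewrite mem_filter eq andbT.
  have rq1 : q \in map fst r by apply/mapP; exists (q, e).
  (* The colour of [q] could only be struck out by a monochromatic collinear triple [p], [y], [q],
     which [chi] does not have. *)
  case: (tri_eqP (chi p) (chi q)) => // epq.
  apply/allP=> -[y j] Ay /=.
  have /= /eqP jE := allP okA _ Ay.
  case: (tri_eqP (chi p) j) => // ej.
  have Ay1 : y \in map fst asg by apply/mapP; exists (y, j).
  move: uA => /= /andP[]; rewrite mem_cat negb_or cat_uniq => /andP[npA npr].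
  case/and3P=> _ /hasPn nAr _.
  apply: capU; rewrite ?mU ?inE ?mem_cat ?eqxx ?Ay1 ?rq1 ?orbT //.
  + by apply: contraNneq npA => ->.
  + by apply: contraNneq (nAr _ rq1) => <-.
  + by apply: contraNneq npr => ->.
  + by rewrite -jE.
- by rewrite rE.
exists a => //; apply/flattenP.
exists (colour k ((p, chi p) :: asg) (map (restrict p (chi p) asg) r)) => //.
exact: (map_f (fun i => colour k ((p, i) :: asg) (map (restrict p i asg) r))).
Qed.

(** * Affine charts *)

Lemma triple0 (x : pt) : (x + x + x = 0)%R.
Proof.
apply/rowP=> i; rewrite !mxE; apply: val_inj.
by case: (x _ i) => [[|[|[|[]]]]].
Qed.

Lemma addr3_eq0 (x y z : pt) : ((x + y + z)%R == 0%R) = (z == - (x + y))%R.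
Proof. by rewrite addrC addr_eq0. Qed.

Lemma third_pt_fix (x y : pt) : ((- (x + y))%R == y) = (x == y).
Proof.
rewrite eq_sym -addr3_eq0 -[RHS]subr_eq0; congr (_ == _).
by rewrite -[RHS]addr0 -(triple0 y) !addrA subrK.
Qed.

Lemma is_lineE (x y z : pt) : is_line x y z = (x != y) && (z == - (x + y))%R.
Proof.
rewrite /is_line addr3_eq0; case: (x =P y) => //= /eqP nxy.
case: (z =P _) => [->|]; rewrite ?andbF // andbT.
rewrite -[y == _]eq_sym third_pt_fix nxy /= addrC -[x == _]eq_sym third_pt_fix.
by rewrite eq_sym.
Qed.

(** A cap as large as one known maximal cap inherits its maximality, so a single example fixes the
    size of all maximal caps. *)
Lemma maxcap_card (M K : {set pt}) :
  maxcap M -> maxcap K = cap K && (#|K| == #|M|).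
Proof.
case/andP=> capM /forallP maxM; rewrite /maxcap; case capK: (cap K) => //=.
apply/forallP/eqP=> [maxK|-> //].
by apply/eqP; rewrite eqn_leq (implyP (maxM K) capK) (implyP (maxK M) capM).
Qed.

(** The map [x] to [-(p + x)] is an involution without fixed points on [E]; the lines completed by
    [p] are its orbits inside [E], each of two points. *)
Lemma ncompl_eq1 (p : pt) (E : {set pt}) : p \notin E ->
  (ncompl p E == 1) = (#|[set x in E | (- (p + x))%R \in E]| == 2).
Proof.
move=> nEp; set F := [set x in E | _].
pose tau x : pt := (- (p + x))%R.
have tauK : involutive tau by move=> x; rewrite /tau opprD opprK addKr.
have tau_neq x : x \in E -> x != tau x.
  by move=> Ex; rewrite eq_sym third_pt_fix; apply: contraNneq nEp => ->.
have Ftau x : x \in F -> tau x \in F.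
  by rewrite !inE => /andP[Ex Etx]; rewrite -/(tau x) -/(tau _) tauK Ex Etx.
have FE x : x \in F -> x \in E by rewrite inE => /andP[].
have -> : ncompl p E = #|[set [set x; tau x] | x in F]|.
  congr #|pred_of_set _|; apply/setP=> U; rewrite inE; apply/existsP/imsetP.
    case=> x /andP[Ex /existsP[y /and4P[Ey nxy]]].
    rewrite is_lineE => /andP[_ /eqP yE] /eqP->.
    by exists x; rewrite ?inE ?Ex -?yE // /tau -yE.
  case=> x Fx ->; exists x; rewrite FE //=; apply/existsP; exists (tau x).
  rewrite (FE _ (Ftau _ Fx)) tau_neq ?FE //= is_lineE !eqxx !andbT.
  by apply: contraNneq nEp => ->; apply: FE.
apply/idP/idP=> [/cards1P[U FU]|/cards2P[x [y [nxy FE2]]]].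
  have [x Fx] : exists x, x \in F.
    have: U \in [set [set x; tau x] | x in F] by rewrite FU set11.
    by case/imsetP=> x Fx _; exists x.
  have UE z : z \in F -> [set z; tau z] = U.
    by move=> Fz; apply/set1P; rewrite -FU; apply: imset_f.
  apply/cards2P; exists x, (tau x); split; first exact/tau_neq/FE.
  apply/setP=> z; rewrite UE //; apply/idP/idP => [Fz|].
    by rewrite -(UE z Fz) set21.
  by rewrite -(UE x Fx) => /set2P[]->; rewrite ?Ftau.
have Fx : x \in F by rewrite FE2 set21.
have Fy : y \in F by rewrite FE2 set22.
have tx : tau x = y.
  have := Ftau _ Fx; rewrite FE2 => /set2P[e|//].
  by have := tau_neq _ (FE _ Fx); rewrite e eqxx.
apply/cards1P; exists [set x; y]; apply/setP=> U; apply/imsetP/set1P=> [[z]|->].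
  rewrite FE2 => /set2P[]-> ->; rewrite ?tx //.
  by rewrite -tx tauK setUC.
by exists x; rewrite ?tx.
Qed.

Lemma imset_set_seq (aT rT : finType) (f : aT -> rT) (s : seq aT) :
  [set f x | x in [set:: s]] = [set:: map f s].
Proof.
apply/setP=> y; rewrite inE; apply/imsetP/mapP=> -[x sx ->]; exists x => //.
  by rewrite inE in sx.
by rewrite inE.
Qed.

(** Counting each point exactly once yields covering and disjointness, and also excludes repeated
    blocks, since these are nonempty. *)
Lemma partition_set_seq (T : finType) (s : seq {set T}) : set0 \notin s ->
    (forall x, count (fun A : {set T} => x \in A) s = 1) ->
  [/\ uniq s, partition [set:: s] [set: T] & #|[set:: s]| = size s].
Proof.
move=> s0 s1.
have us : uniq s.
  apply: count_mem_uniq => A; case sA: (A \in s); last exact/count_memPn/negbT.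
  have /set0Pn[x Ax] : A != set0 by apply: contraNneq s0 => <-.
  have le1 : count_mem A s <= 1 by rewrite -(s1 x); apply: sub_count => B /= /eqP->.
  by apply/eqP; rewrite eqn_leq le1 -has_count has_pred1.
split=> //; last by rewrite cardsE; apply/card_uniqP.
apply/and3P; split; last by rewrite inE.
  apply/eqP/setP=> x; rewrite inE; apply/bigcupP.
  have /hasP[A sA Ax] : has (fun A : {set T} => x \in A) s by rewrite has_count s1.
  by exists A; rewrite ?inE.
apply/trivIsetP=> A B; rewrite !inE => sA sB nAB.
apply/pred0P=> x /=; apply/negP=> /andP[Ax Bx].
(* If [x] lay in two different blocks [A] and [B], inclusion-exclusion would count two blocks among
   those containing [x]. *)
have : count (predU (pred1 A) (pred1 B)) s <= 1.
  by rewrite -(s1 x); apply: sub_count => D /= /orP[] /eqP->.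
have: count (predI (pred1 A) (pred1 B)) s = 0.
  apply/eqP; rewrite -leqn0 leqNgt -has_count; apply/hasPn=> D _ /=.
  by apply: contra nAB => /andP[/eqP<- /eqP<-].
have := count_predUI (pred1 A) (pred1 B) s.
by rewrite !count_uniq_mem // sA sB => /= e e0; rewrite e0 addn0 in e; rewrite e.
Qed.

(** An affine coordinate system, with affineness expressed as preservation of the relation
    [x + y + z = 0] that defines lines. *)
Record chart := Chart {
  cg : code -> pt;
  ch : pt -> code;
  cgK : cancel cg ch;
  chK : cancel ch cg;
  cg_sum : forall x y z, ((cg x + cg y + cg z)%R == 0%R) = zsum x y z }.

Definition img (c : chart) (l : seq code) : {set pt} := [set x | ch c x \in l].

Section ChartTheory.

Variable c : chart.
Local Notation S := (img c).

Lemma cg_inj : injective (cg c). Proof. exact: can_inj (cgK c). Qed.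

Lemma mem_img t l : (cg c t \in S l) = (t \in l).
Proof. by rewrite inE cgK. Qed.

Lemma img_eq l l' : l =i l' -> S l = S l'.
Proof. by move=> e; apply/setP=> x; rewrite !inE e. Qed.

Lemma img_nf l : S (nf l) = S l. Proof. exact/img_eq/mem_nf. Qed.

Lemma img_inj l l' : S l = S l' -> nf l = nf l'.
Proof. by move=> e; apply: nf_eq => t; rewrite -!mem_img e. Qed.

Definition preimg (K : {set pt}) : seq code := [seq t <- codes | cg c t \in K].

Lemma mem_preimg K t : (t \in preimg K) = (cg c t \in K).
Proof. by rewrite mem_filter mem_codes andbT. Qed.

Lemma preimg_uniq K : uniq (preimg K). Proof. exact/filter_uniq/codes_uniq. Qed.

Lemma nf_preimg K : nf (preimg K) = preimg K. Proof. exact: nf_filter. Qed.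

Lemma img_preimg K : S (preimg K) = K.
Proof. by apply/setP=> x; rewrite inE mem_preimg chK. Qed.

Lemma card_img l : uniq l -> #|S l| = size l.
Proof.
move=> ul; rewrite -(size_map (cg c)) -(card_uniqP (_ : uniq (map (cg c) l))).
  apply: eq_card => x; rewrite inE -{2}[x](chK c) mem_map //; exact: cg_inj.
by rewrite map_inj_uniq //; exact: cg_inj.
Qed.

Lemma img_cat l l' : S (l ++ l') = S l :|: S l'.
Proof. by apply/setP=> x; rewrite !inE mem_cat. Qed.

Lemma img_diff l l' : S l :\: S l' = S [seq x <- l | ~~ memc x l'].
Proof. by apply/setP=> x; rewrite !inE mem_filter memcE. Qed.

Lemma img1 t : S [:: t] = [set cg c t].
Proof. by apply/setP=> x; rewrite !inE; apply/eqP/eqP=> [<-|->]; rewrite ?chK ?cgK. Qed.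

Lemma is_line_cg x y z : is_line (cg c x) (cg c y) (cg c z) = (x != y) && zsum x y z.
Proof. by rewrite is_lineE -addr3_eq0 cg_sum (inj_eq cg_inj). Qed.

Lemma cg_third x y : (- (cg c x + cg c y))%R = cg c (third x y).
Proof. by apply/esym/eqP; rewrite -addr3_eq0 cg_sum zsumE. Qed.

Lemma cap_img l : reflect (cap_seq l) (cap (S l)).
Proof.
apply: (iffP forall_inP) => [capl p q r lp lq lr npq|capl p Sp].
  have /forall_inP capp := capl (cg c p) (etrans (mem_img _ _) lp).
  have /forall_inP/(_ (cg c r)) := capp (cg c q) (etrans (mem_img _ _) lq).
  by rewrite mem_img is_line_cg npq; apply.
apply/forall_inP=> q Sq; apply/forall_inP=> r Sr.
rewrite -[p](chK c) -[q](chK c) -[r](chK c) is_line_cg.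
rewrite !inE in Sp Sq Sr; apply/negP=> /andP[npq]; apply/negP; exact: capl.
Qed.

Lemma anchor_img t l : anchor (cg c t) (S l) ->
  t \notin l /\ {in l, forall x, third t x \in l}.
Proof.
case/andP; rewrite mem_img => nlt /forall_inP H; split=> // x lx.
have /exists_inP[y Sy] := H (cg c x) (etrans (mem_img _ _) lx).
rewrite is_lineE => /andP[_ /eqP yE]; by rewrite -mem_img -cg_third -yE.
Qed.

Lemma third0 x : third origin x = copp x.
Proof. by case: x. Qed.

Lemma anchor_img0 l : origin \notin l -> {in l, forall x, copp x \in l} ->
  anchor (cg c origin) (S l).
Proof.
move=> l0 Nl; apply/andP; split; first by rewrite mem_img.
apply/forall_inP=> x; rewrite inE => lx; apply/exists_inP.
exists (cg c (copp (ch c x))); first by rewrite mem_img Nl.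
rewrite -[x in is_line _ x](chK c) is_line_cg zsumE third0 eqxx andbT.
by apply: contraNneq l0 => ->.
Qed.

Lemma ncompl_img t l : uniq l -> t \notin l ->
  (ncompl (cg c t) (S l) == 1) = on_one_line t l.
Proof.
move=> ul nlt; rewrite ncompl_eq1 ?mem_img // /on_one_line.
rewrite -(card_img (filter_uniq _ ul)); congr (#|pred_of_set _| == _).
by apply/setP=> x; rewrite !inE mem_filter memcE -{2}[x](chK c) cg_third cgK andbC.
Qed.

Lemma phi_img : Phi (cg c origin) (S frame) (S frame') = S phi_cap.
Proof.
rewrite -phi_capE; apply/setP=> x; rewrite -[x](chK c); move: (ch c x) => {x} t.
have: uniq frame && uniq frame' by [].
rewrite mem_img mem_filter mem_codes andbT inE /in_phi memcE.
(* The concrete lists are generalised so that simplification does not unfold them. *)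
move: frame frame' origin => A B o /andP[uA uB].
rewrite !in_setU in_set1 !mem_img (inj_eq cg_inj) in_cons mem_cat orbC.
case: (t == o) => //=.
case: (boolP (t \in A)) => //= nA; case: (boolP (t \in B)) => //= nB.
by rewrite !ncompl_img.
Qed.

Lemma img_seq_card (L : seq (seq code)) : uniq L -> {in L, forall l, nf l = l} ->
  #|[set:: map S L]| = size L.
Proof.
move=> uL nfL; rewrite cardsE -(size_map S); apply/card_uniqP.
by rewrite map_inj_in_uniq // => l l' Ll Ll' /img_inj; rewrite !nfL.
Qed.

Hypothesis maxcapE : forall K, maxcap K = cap K && (#|K| == 20).

Lemma maxcap_img l : uniq l -> size l = 20 -> capb l -> maxcap (S l).
Proof.
by move=> ul szl /(capbP ul) cl; rewrite maxcapE card_img // szl eqxx andbT; apply/cap_img.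
Qed.

(** One inclusion is completeness of the search; the other is the test of every list entry in the
    last hypothesis. *)
Lemma maxcaps_over D L : extensions D = L -> uniq D -> size D = 10 ->
    all (fun l => [&& size l == 20, capb l & all (fun x => memc x l) D]) L ->
  [set K : {set pt} | maxcap K && (S D \subset K)] = [set:: map S L].
Proof.
move=> EL uD szD /allP H; apply/setP=> K; rewrite !inE.
apply/andP/mapP => [[]|[l Ll ->]].
  rewrite maxcapE => /andP[capK /eqP szK] DK; exists (preimg K); last by rewrite img_preimg.
  rewrite -nf_preimg -EL; apply: extensions_complete => //.
  - by rewrite nf_preimg -card_img ?preimg_uniq // img_preimg.
  - by move=> x Dx; rewrite mem_preimg (subsetP DK) // mem_img.
  by apply/cap_img; rewrite img_preimg.
have /and3P[/eqP szl capl /allP Dl] := H _ Ll.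
have nl : nf l = l by apply: (@extensions_nf D); rewrite EL.
split; first by apply: maxcap_img; rewrite // -nl nf_uniq.
by apply/subsetP=> x; rewrite !inE => /Dl; rewrite memcE.
Qed.

End ChartTheory.

(** * Partitions containing the cap *)

(** Every point other than the origin is refuted as an anchor: some point of [l] has its partner
    outside [l]. *)
Definition centred (l : seq code) : bool :=
  all (fun t => (t == origin) || ~~ all (fun x => memc (third t x) l) l) codes.

Lemma phi_cap_centred : centred phi_cap. Proof. by vm_compute. Qed.

Lemma phi_cap_size : size phi_cap = 20. Proof. by vm_compute. Qed.

Lemma phi_cap_cap : capb phi_cap. Proof. by vm_compute. Qed.

Lemma nf_phi_cap : nf phi_cap = phi_cap. Proof. by rewrite -phi_capE nf_filter. Qed.

Lemma phi_cap_uniq : uniq phi_cap. Proof. by rewrite -nf_phi_cap nf_uniq. Qed.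

Lemma phi_cap_opp x : (copp x \in phi_cap) = (x \in phi_cap).
Proof.
have /allP H : all (fun x => memc (copp x) phi_cap) phi_cap by vm_compute.
by apply/idP/idP=> /H; rewrite memcE ?coppK.
Qed.

Lemma has_colourE x i a : has_colour x i a = ((x, i) \in a).
Proof.
elim: a => //= -[y j] a IHa; rewrite inE /= IHa -[(x, i) == (y, j)]/((x == y) && (i == j)).
rewrite -[tri_eqb i j]/(i == j) -[code_eqb x y]/(x == y).
by case: (i == j); case: (x == y).
Qed.

Lemma mem_block a i x : (x \in block a i) = ((x, i) \in a) || ((copp x, i) \in a).
Proof. by rewrite mem_filter mem_codes andbT -!has_colourE; case: ifP. Qed.

Lemma block_opp a i x : (copp x \in block a i) = (x \in block a i).
Proof. by rewrite !mem_block coppK orbC. Qed.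

Lemma partitions_blocks s : s \in partitions -> exists a, s = blocks a.
Proof. by rewrite -partitionsE => /mapP[a _ ->]; exists a. Qed.

Lemma partitions_nf s l : s \in partitions -> l \in s -> nf l = l.
Proof. by case/partitions_blocks=> a -> /mapP[i _ ->]; apply: nf_filter. Qed.

Lemma partitions_opp s l x : s \in partitions -> l \in s ->
  x \in l -> copp x \in l.
Proof. by case/partitions_blocks=> a -> /mapP[i _ ->]; rewrite block_opp. Qed.

Lemma partitions_cap s l : s \in partitions -> l \in s -> size l = 20 /\ capb l.
Proof.
move=> /(allP partitions_valid); rewrite /valid_partition.
case: allP => // H _ /H; by case: eqP.
Qed.

Lemma partitions_count s t : s \in partitions ->
  count (fun l => t \in l) (all_blocks s) = 1.
Proof.
move=> /(allP partitions_valid); rewrite /valid_partition.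
case: ifP => // _ H; have /eqP<- := allP H t (mem_codes t).
by apply: eq_count => l; rewrite memcE.
Qed.

Lemma memlE l s : meml l s = (l \in s).
Proof.
rewrite /meml; apply/hasP/idP => [[k sk /eqP->] //|sl].
by exists l => //; rewrite -[eqseq _ _]/(l == l).
Qed.

Section Partitions.

Variable c : chart.
Local Notation S := (img c).

Lemma anchor_origin l a : centred l -> anchor a (S l) -> a = cg c origin.
Proof.
rewrite -[a](chK c); move: (ch c a) => t cl.
have := allP cl t (mem_codes t); case: eqP => [-> //|_] /= /negP H /anchor_img[_ Hl].
by case: H; apply/allP=> x /Hl; rewrite memcE.
Qed.

Definition partition_of (s : seq (seq code)) : {set {set pt}} :=
  [set:: map S (all_blocks s)].

Lemma partition_ofP s : s \in partitions ->
  [/\ uniq (map S (all_blocks s)), partition (partition_of s) [set: pt]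
    & #|partition_of s| = 5].
Proof.
move=> Ps; have [|x|u p card5] := @partition_set_seq _ (map S (all_blocks s)).
- apply/mapP=> -[l]; rewrite !inE => sl /setP l0.
  have: size l != 0.
    by case/or3P: sl => [/eqP->|/eqP->|/(partitions_cap Ps)[-> _]].
  case: l l0 {sl} => // t l /(_ (cg c t)); by rewrite mem_img mem_head inE.
- rewrite count_map -(partitions_count (ch c x) Ps).
  by apply: eq_count => l /=; rewrite inE.
split=> //; rewrite /partition_of card5 size_map.
by case: (partitions_blocks Ps) => a ->.
Qed.

Hypothesis maxcapE : forall K, maxcap K = cap K && (#|K| == 20).

Lemma partition_of_blocks s l : s \in partitions -> l \in phi_cap :: s ->
  maxcap (S l) /\ anchor (cg c origin) (S l).
Proof.
move=> Ps; rewrite inE => /predU1P[->|sl].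
  split; first exact: (maxcap_img c maxcapE phi_cap_uniq phi_cap_size phi_cap_cap).
  by apply: anchor_img0 => // x; rewrite phi_cap_opp.
have [szl capl] := partitions_cap Ps sl.
have ul : uniq l by rewrite -(partitions_nf Ps sl) nf_uniq.
split; first exact: (maxcap_img c maxcapE).
apply: anchor_img0 => [|x lx]; last exact: (partitions_opp Ps sl).
(* The block [[:: origin]] already contains the origin, so a second block containing it would raise
   the count above 1. *)
apply/negP=> lo; have := partitions_count origin Ps.
have: 0 < count (fun k : seq code => origin \in k) s.
  by rewrite -has_count; apply/hasP; exists l.
by rewrite /all_blocks /=; case: (count _ s) => // n _; rewrite !addnS.
Qed.

Lemma partition_of_is_partition s : s \in partitions ->
  [/\ is_partition (partition_of s), S phi_cap \in partition_of s
    & forall l, l \in s -> S l \in partition_of s].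
Proof.
move=> Ps; have [u p card5] := partition_ofP Ps.
have mS l : l \in all_blocks s -> S l \in partition_of s.
  by move=> sl; rewrite inE map_f.
split; last by move=> l sl; rewrite mS // !inE sl !orbT.
  apply/existsP; exists (cg c origin); rewrite -img1 mS ?mem_head // card5 p eqxx.
  apply/forall_inP=> K; rewrite inE => /mapP[l]; rewrite inE => /predU1P[-> ->|sl ->].
    by rewrite eqxx.
  by have [-> ->] := partition_of_blocks Ps sl; rewrite implybT.
by rewrite mS // !inE eqxx !orbT.
Qed.

(** Normal forms make [img] injective, and the size 20 excludes the singleton block. *)
Lemma mem_partition_of s l : s \in partitions -> nf l = l -> size l = 20 ->
  (S l \in partition_of s) = (l \in phi_cap :: s).
Proof.
move=> Ps nl szl; rewrite in_set [RHS]inE; apply/mapP/idP=> [[k]|sl]; last first.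
  by exists l; rewrite // !inE sl orbT.
rewrite inE => /predU1P[-> /img_inj|sk /img_inj].
  by rewrite nl => e; rewrite e in szl.
rewrite nl => ->; move: sk; rewrite inE => /predU1P[->|sk].
  by rewrite nf_phi_cap eqxx.
by rewrite (partitions_nf Ps sk) sk orbT.
Qed.

Lemma phi_cap_notin s : s \in partitions -> phi_cap \notin s.
Proof.
move=> /partition_ofP[] /= /and3P[_ + _] _ _; apply: contra; exact: map_f.
Qed.

End Partitions.

(** * Completeness of the list of partitions *)

Lemma positive_opp x : x != origin -> positive (copp x) = ~~ positive x.
Proof. by case: x; do 4![case]. Qed.

Lemma reps_uniq : uniq reps. Proof. exact/filter_uniq/codes_uniq. Qed.

Lemma mem_reps x : (x \in reps) = positive x && (x \notin phi_cap).
Proof. by rewrite mem_filter mem_codes andbT memcE. Qed.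

Lemma reps_opp x : x != origin -> x \notin phi_cap ->
  (x \in reps) || (copp x \in reps).
Proof. by move=> x0 nx; rewrite !mem_reps phi_cap_opp nx !andbT positive_opp // orbN. Qed.

Lemma reps_neq_opp x y : x \in reps -> y \in reps -> x != copp y.
Proof.
rewrite !mem_reps => /andP[px _] /andP[py _]; apply/eqP=> e.
have y0 : y != origin by apply: contraTneq py => ->.
by rewrite e positive_opp // py in px.
Qed.

Lemma reps_origin x : x \in reps -> x != origin.
Proof. by rewrite mem_reps; apply: contraTneq => ->. Qed.

Lemma reps_phi x : x \in reps -> x \notin phi_cap.
Proof. by rewrite mem_reps => /andP[]. Qed.

Lemma start_perm d0 d1 d2 : perm_eq (map fst (start d0 d1 d2)) reps.
Proof. by vm_compute. Qed.

(** The four sign patterns in [bad] are sums of points of the symmetric cap [K]. The patterns with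
    opposite signs at [p] and [q] need [p != copp q], which holds for representatives. *)
Lemma bad_cap p q r K : cap_seq K -> {in K, forall x, copp x \in K} ->
    p \in reps -> q \in reps -> p != q -> p \in K -> q \in K -> r \in K -> ~~ bad p q r.
Proof.
move=> capK NK hp hq npq Kp Kq Kr; rewrite /bad.
rewrite (negPf (capK _ _ _ Kp Kq Kr npq)) (negPf (capK _ _ _ Kp Kq (NK _ Kr) npq)).
rewrite (negPf (capK _ _ _ Kp (NK _ Kq) Kr _)) ?reps_neq_opp //.
by apply: capK; rewrite ?NK // eq_sym reps_neq_opp.
Qed.

Section PartitionsComplete.

Variable c : chart.
Local Notation S := (img c).

Hypothesis maxcapE : forall K, maxcap K = cap K && (#|K| == 20).

Lemma preimg_cap K : cap K -> cap_seq (preimg c K).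
Proof. by move=> capK; apply/(cap_img c); rewrite img_preimg. Qed.

Lemma preimg_opp K : anchor (cg c origin) K -> {in preimg c K, forall x, copp x \in preimg c K}.
Proof.
rewrite -{1}[K](img_preimg c) => /anchor_img[_ H] x Kx.
by rewrite -third0; apply: H.
Qed.

(** The cap [S phi_cap] forces the anchor to be the origin, so all blocks are symmetric. The three
    other blocks colour [reps] without a monochromatic line; once they are named as in [colourings],
    the search finds this colouring. *)
Lemma partitions_complete P : is_partition P -> S phi_cap \in P ->
  exists2 s, s \in partitions & P = partition_of c s.
Proof.
case/existsP=> a /and4P[Pa /eqP card5 partP /forall_inP PK] PC.
have [/eqP covP trivP nP0] := and3P partP.
have maxK K : K \in P -> K != [set a] -> maxcap K /\ anchor a K.
  by move=> PK1 nKa; apply/andP; apply: implyP (PK K PK1) nKa.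
have Ca : S phi_cap != [set a].
  apply/eqP=> /(congr1 (fun A : {set pt} => #|A|)).
  by rewrite cards1 card_img ?phi_cap_uniq // phi_cap_size.
have aE : a = cg c origin.
  by have [_] := maxK _ PC Ca; apply: anchor_origin; apply: phi_cap_centred.
have disj A B x : A \in P -> B \in P -> x \in A -> x \in B -> A = B.
  move=> PA PB Ax Bx; apply/eqP; apply/idPn=> nAB.
  by have /pred0P/(_ x) := trivIsetP trivP A B PA PB nAB; rewrite /= Ax Bx.
have in_pblock x : x \in pblock P x by rewrite mem_pblock covP inE.
have Ppblock x : pblock P x \in P by apply: pblock_mem; rewrite covP inE.
have proper_block K t : K \in P -> t \in reps -> cg c t \in K ->
    [/\ K != [set a], K != S phi_cap, cap_seq (preimg c K)
      & {in preimg c K, forall x, copp x \in preimg c K}].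
  move=> PK1 ht Kt.
  have nKa : K != [set a].
    apply: contraTneq Kt => ->; rewrite aE inE (inj_eq (@cg_inj c)).
    exact: reps_origin.
  have [/andP[capK _] ancK] := maxK _ PK1 nKa.
  split=> //; last by apply: preimg_opp; rewrite -aE.
    by apply: contraTneq Kt => ->; rewrite mem_img reps_phi.
  exact: preimg_cap.
have hq0 : q0 \in reps by vm_compute.
have hq1 : q1 \in reps by vm_compute.
have hq2 : q2 \in reps by vm_compute.
(* [K1] and [K2] follow the naming of colours in [colourings]: the block of [q0], then the block of
   the first of [q1], [q2] outside [K1]. *)
pose K1 := pblock P (cg c q0).
pose K2 := if cg c q1 \in K1 then pblock P (cg c q2) else pblock P (cg c q1).
have PK1 : K1 \in P by apply: Ppblock.
have PK2 : K2 \in P by rewrite /K2; case: ifP => _; apply: Ppblock.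
have K1q0 : cg c q0 \in K1 by apply: in_pblock.
have [nK1a nK1C capK1 NK1] := proper_block _ _ PK1 hq0 K1q0.
(* Since [q0 - q1 + q2 = 0], a symmetric cap cannot contain all three. *)
have q2P : cg c q1 \in K1 -> cg c q2 \notin K1.
  rewrite -!mem_preimg => Kq1; apply/negP=> Kq2.
  have := bad_cap capK1 NK1 hq0 hq1 isT _ Kq1 Kq2.
  by rewrite mem_preimg => /(_ K1q0).
have [t ht K2t] : exists2 t, t \in reps & cg c t \in K2.
  by rewrite /K2; case: ifP => _; [exists q2 | exists q1].
have [nK2a nK2C capK2 NK2] := proper_block _ _ PK2 ht K2t.
have nK12 : K1 != K2.
  apply/eqP=> e; move: (erefl K2); rewrite {2}/K2 -e; case: ifP => Kq1 e'.
    by have := q2P Kq1; rewrite e' in_pblock.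
  by move: Kq1; rewrite e' in_pblock.
have [K3 PE] : exists K3, P :\ [set a] :\ S phi_cap :\ K1 :\ K2 = [set K3].
  apply/cards1P; move: card5.
  rewrite (cardsD1 [set a]) Pa (cardsD1 (S phi_cap)) !inE Ca PC.
  rewrite (cardsD1 K1) !inE nK1a nK1C PK1 (cardsD1 K2) !inE.
  by rewrite eq_sym nK12 nK2a nK2C PK2 !add1n => -[->].
have : K3 \in [set K3] by rewrite set11.
rewrite -PE !inE => /and5P[nK32 nK31 nK3C nK3a PK3].
have PI K : K \in P -> [|| K == [set a], K == S phi_cap, K == K1, K == K2 | K == K3].
  move=> PK0; have := in_set1 K K3; rewrite -PE !inE PK0 andbT => <-.
  by case: (K == K2); case: (K == K1); case: (K == S phi_cap); case: (K == [set a]).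
pose bl i := match i with t0 => K1 | t1 => K2 | t2 => K3 end.
have Pbl i : bl i \in P by case: i.
have bl_a i : bl i != [set a] by case: i.
have bl_C i : bl i != S phi_cap by case: i.
have bl_inj i j : bl i = bl j -> i = j.
  by case: i; case: j => //= /eqP; rewrite ?(eq_sym K2 K1) ?(eq_sym _ K3)
    ?(negPf nK12) ?(negPf nK31) ?(negPf nK32).
pose chi t := if cg c t \in K1 then t0 else if cg c t \in K2 then t1 else t2.
have chiP i x : cg c x \in bl i -> chi x = i.
  move=> xi; apply: bl_inj; apply: (disj _ _ (cg c x)) => //.
  rewrite /chi; case: ifP => //= n1; case: ifP => //= n2.
  by move: xi; case: i => /=; rewrite ?n1 ?n2.
have bl_out i x : cg c x \in bl i -> x != origin /\ x \notin phi_cap.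
  move=> xi; split.
    apply: contraNneq (bl_a i) => x0; apply/eqP/(disj _ _ (cg c x)) => //.
    by rewrite aE x0 set11.
  apply: contraNN (bl_C i) => Cx; apply/eqP/(disj _ _ (cg c x)) => //.
  by rewrite mem_img.
have bl_chi x : x \in reps -> cg c x \in bl (chi x).
  move=> hx; case/or4P: (PI _ (Ppblock (cg c x))) (in_pblock (cg c x)) => [||/eqP->|/orP[]].
  - move/eqP->; rewrite aE inE (inj_eq (@cg_inj c)) => /eqP x0.
    by have := reps_origin hx; rewrite x0.
  - by move/eqP->; rewrite mem_img (negPf (reps_phi hx)).
  - by move=> x1; rewrite (chiP t0).
  - by move/eqP-> => x1; rewrite (chiP t1).
  - by move/eqP-> => x1; rewrite (chiP t2).
have bl_opp i x : cg c x \in bl i -> cg c (copp x) \in bl i.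
  rewrite -!mem_preimg; apply: preimg_opp; rewrite -aE.
  by have [] := maxK _ (Pbl i) (bl_a i).
have bl_cap i : cap (bl i) by have [/andP[]] := maxK _ (Pbl i) (bl_a i).
have chi_cap p q r : p \in reps -> q \in reps -> r \in reps -> p != q -> q != r ->
    p != r -> chi q = chi p -> chi r = chi p -> ~~ bad p q r.
  move=> hp hq hr npq _ _ eq er.
  apply: (bad_cap (K := preimg c (bl (chi p))) _ _ hp hq npq).
  - exact: preimg_cap.
  - by apply: preimg_opp; rewrite -aE; have [] := maxK _ (Pbl (chi p)) (bl_a _).
  - by rewrite mem_preimg bl_chi.
  - by rewrite mem_preimg -eq bl_chi.
  - by rewrite mem_preimg -er bl_chi.
have [a' Ca' /andP[a'chi a'reps]] : exists2 a', a' \in colourings &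
    all (fun qi => qi.2 == chi qi.1) a' && perm_eq (map fst a') reps.
  have col d0 d1 d2 : chi q0 \in d0 -> chi q1 \in d1 -> chi q2 \in d2 ->
      exists2 a', a' \in colour 81 [::] (start d0 d1 d2) &
      all (fun qi => qi.2 == chi qi.1) a' && perm_eq (map fst a') reps.
    move=> c0 c1 c2; apply: (colour_complete reps_uniq chi_cap).
    - by rewrite -(size_map fst) (perm_size (start_perm _ _ _)).
    - by [].
    - rewrite /start all_cat all_map; apply/andP; split; first by apply/and4P.
      by apply/allP=> x _; rewrite /=; case: (chi x).
    - exact: start_perm.
  have c0 : chi q0 = t0 by rewrite /chi K1q0.
  (* The two cases are the two starting positions of the search. *)
  rewrite /colourings; case K1q1: (cg c q1 \in K1).
    have c1 : chi q1 = t0 by rewrite /chi K1q1.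
    have c2 : chi q2 = t1 by rewrite /chi (negPf (q2P K1q1)) /K2 K1q1 in_pblock.
    have := col [:: t0] [:: t0] [:: t1]; rewrite c0 c1 c2.
    case/(_ isT isT isT)=> a' Ha Hb; exists a'; last exact: Hb.
    by rewrite mem_cat Ha.
  have c1 : chi q1 = t1 by rewrite /chi K1q1 /K2 K1q1 in_pblock.
  have c2 : chi q2 \in tris by case: (chi q2).
  have := col [:: t0] [:: t1] tris; rewrite c0 c1.
  case/(_ isT isT c2)=> a' Ha Hb; exists a'; last exact: Hb.
  by rewrite mem_cat Ha orbT.
have mem_a' x i : ((x, i) \in a') = (x \in reps) && (chi x == i).
  rewrite -(perm_mem a'reps); apply/idP/andP=> [axi|[/mapP[[y j] ayj /= ->] /eqP<-]].
    split; first by apply/mapP; exists (x, i).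
    by have /= := allP a'chi _ axi; rewrite eq_sym.
  by have /= /eqP<- := allP a'chi _ ayj.
(* The assignment [a'] is [chi] on [reps], and closing a colour class under negation gives back the
   whole symmetric block. *)
have block_bl i : S (block a' i) = bl i.
  apply/setP=> x; rewrite -[x](chK c); move: (ch c x) => {x} x.
  rewrite mem_img mem_block !mem_a'; apply/idP/idP=> [/orP[]/andP[hx /eqP<-]|xi].
  - exact: bl_chi.
  - by rewrite -{1}[x]coppK; apply: bl_opp; apply: bl_chi.
  have [x0 nx] := bl_out _ _ xi.
  by rewrite (chiP _ _ xi) (chiP _ _ (bl_opp _ _ xi)) eqxx !andbT reps_opp.
exists (blocks a'); first by rewrite -partitionsE map_f.
have bl5 : map S (all_blocks (blocks a')) = [:: [set a]; S phi_cap; K1; K2; K3].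
  rewrite /all_blocks /blocks /tris !map_cons aE -(img1 c origin).
  move: (block_bl t0) (block_bl t1) (block_bl t2); move: (block a' t0) (block a' t1) (block a' t2).
  by move=> b0 b1 b2 -> -> ->.
apply/setP=> K; rewrite /partition_of bl5 in_set !inE; apply/idP/idP=> [/PI //|].
by case/or4P=> [/eqP->|/eqP->|/eqP->|/orP[]/eqP->].
Qed.

Lemma card_partitions_over l : occurs_once l -> nf l = l -> size l = 20 ->
    l != phi_cap ->
  exists2 s, (s \in partitions) && (l \in s) &
    [set P | is_partition P && (S phi_cap \in P) && (S l \in P)]
    = [set partition_of c s].
Proof.
rewrite /occurs_once; case E: [seq s <- partitions | meml l s] => [|s [|]] // _ nl szl nlC.
have sE s' : (s' \in partitions) && (l \in s') = (s' == s).
  by rewrite -[RHS]mem_seq1 -E mem_filter memlE andbC.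
have /andP[Ps ls] := etrans (sE s) (eqxx s).
exists s; first by rewrite Ps.
apply/setP=> P; rewrite in_set in_set1; apply/idP/eqP=> [/andP[/andP[PP PC] Pl]|->].
  have [s' Ps' PE] := partitions_complete PP PC.
  move: Pl; rewrite PE mem_partition_of // inE (negPf nlC) /= => ls'.
  by have := sE s'; rewrite Ps' ls' => /esym/eqP->.
by have [-> -> ->] := partition_of_is_partition c maxcapE Ps.
Qed.

Lemma completable1 K : completable 1 (S phi_cap) K = (K \in map S products).
Proof.
have maxC : maxcap (S phi_cap).
  exact: (maxcap_img c maxcapE phi_cap_uniq phi_cap_size phi_cap_cap).
apply/idP/mapP=> [/and4P[_ maxK disCK /cards1P[P0 EP]]|[l pl ->]].
  have : P0 \in [set P0] by rewrite set11.
  rewrite -EP inE => /andP[/andP[PP PC] PK].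
  have [s Ps PE] := partitions_complete PP PC.
  move: PK; rewrite PE in_set => /mapP[l]; rewrite inE => /predU1P[->|].
    by rewrite img1 => KE; move: maxK; rewrite maxcapE KE cards1 andbF.
  rewrite inE => /predU1P[->|sl] KE.
    move: disCK; rewrite KE -setI_eq0 setIid => /eqP C0; move: maxK.
    by rewrite KE C0 maxcapE cards0 andbF.
  exists l => //; rewrite -memlE.
  have := allP (allP non_products_twice _ Ps) _ sl; case: (meml l products) => //.
  rewrite /occurs_twice; case E: [seq s <- partitions | meml l s] => [|s1 [|s2 L]] //.
  have /andP[Ps1 ls1] : (s1 \in partitions) && (l \in s1).
    by rewrite -memlE andbC -mem_filter E mem_head.
  have /andP[Ps2 ls2] : (s2 \in partitions) && (l \in s2).
    by rewrite -memlE andbC -mem_filter E !inE eqxx orbT.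
  have P0E s' : s' \in partitions -> l \in s' -> partition_of c s' = P0.
    move=> Ps' ls'; apply/set1P; rewrite -EP in_set KE.
    by have [-> -> ->] := partition_of_is_partition c maxcapE Ps'.
  (* As both [s1] and [s2] give [P0], every block of [s1] is a block of [s2], against
     [occurs_twice]. *)
  case/negP; apply/allP=> k sk; rewrite memlE.
  have [_ _ /(_ _ sk)] := partition_of_is_partition c maxcapE Ps1.
  rewrite (P0E _ Ps1 ls1) -(P0E _ Ps2 ls2) mem_partition_of //; first last.
  - by have [] := partitions_cap Ps1 sk.
  - exact: (partitions_nf Ps1 sk).
  by rewrite inE; case: eqP => //= kC; have := phi_cap_notin c Ps1; rewrite -kC sk.
have [szl lC] : size l = 20 /\ l != phi_cap.
  have /allP/(_ l pl)/andP[/eqP] : all (fun k => (size k == 20) && (k != phi_cap)) products.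
    by vm_compute.
  by [].
have nl : nf l = l.
  by move: pl; rewrite -productsE => /allpairsP[rd [_ _ ->]]; apply: nf_nf.
have := allP products_once _ pl => /card_partitions_over/(_ nl szl lC)[s /andP[Ps ls] EP].
have Cl : S phi_cap != S l.
  by apply: contraNneq lC => /img_inj; rewrite nf_phi_cap nl => ->.
have [_ PC Pl] := partition_of_is_partition c maxcapE Ps.
have [_ /and3P[_ trivP _] _] := partition_ofP c Ps.
apply/and4P; split=> //; last by rewrite EP cards1.
  by have [] := partition_of_blocks c maxcapE Ps (_ : l \in phi_cap :: s); rewrite // inE ls orbT.
by apply: (trivIsetP trivP) => //; apply: Pl.
Qed.

End PartitionsComplete.

(** * The chart of a demicap *)

Section FrameCharts.

Local Open Scope ring_scope.

Definition to_F3 (a : tri) : 'F_3 := match a with t0 => 0 | t1 => 1 | t2 => -1 end.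

Definition of_F3 (u : 'F_3) : tri := if u == 0 then t0 else if u == 1 then t1 else t2.

Lemma to_F3K : cancel to_F3 of_F3. Proof. by case. Qed.

Lemma of_F3K : cancel of_F3 to_F3.
Proof. by case=> [[|[|[|[]]]]] // u; apply: val_inj. Qed.

Lemma to_F3D a b : to_F3 (tadd a b) = to_F3 a + to_F3 b.
Proof. by case: a b => [] []; apply: val_inj. Qed.

Lemma to_F3N a : to_F3 (topp a) = - to_F3 a.
Proof. by case: a; apply: val_inj. Qed.

Definition coord (x : code) (i : 'I_4) : tri :=
  let: Code a b c d := x in nth t0 [:: a; b; c; d] i.

Definition vec (x : code) : pt := \row_i to_F3 (coord x i).

Definition unvec (v : pt) : code :=
  Code (of_F3 (v 0 (inord 0))) (of_F3 (v 0 (inord 1)))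
       (of_F3 (v 0 (inord 2))) (of_F3 (v 0 (inord 3))).

Lemma vecK : cancel vec unvec.
Proof. by case=> a b c d; rewrite /unvec !mxE /coord !inordK //= !to_F3K. Qed.

Lemma unvecK : cancel unvec vec.
Proof.
move=> v; apply/rowP=> i; rewrite !mxE /=.
by case: i => [[|[|[|[|[]]]]]] //= H; rewrite of_F3K; congr (v _ _);
  apply: val_inj; rewrite /= inordK.
Qed.

Lemma vecD x y : vec (cadd x y) = vec x + vec y.
Proof.
case: x y => a b c d [a' b' c' d']; apply/rowP=> i; rewrite !mxE -to_F3D.
by case: i => [[|[|[|[|[]]]]]].
Qed.

Lemma vecN x : vec (copp x) = - vec x.
Proof.
case: x => a b c d; apply/rowP=> i; rewrite !mxE -to_F3N.
by case: i => [[|[|[|[|[]]]]]].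
Qed.

Section AffineChart.

Variables (a : pt) (M : 'M['F_3]_4).
Hypothesis uM : M \in unitmx.

Definition aff (x : code) : pt := a + vec x *m M.
Definition affV (y : pt) : code := unvec ((y - a) *m invmx M).

Lemma affK : cancel aff affV.
Proof. by move=> x; rewrite /affV /aff addrC addKr mulmxK // vecK. Qed.

Lemma affVK : cancel affV aff.
Proof. by move=> y; rewrite /affV /aff unvecK mulmxKV // addrC subrK. Qed.

Lemma aff_sum x y z : (aff x + aff y + aff z == 0) = zsum x y z.
Proof.
(* The three translations by [a] add up to [3a = 0], leaving the linear part. *)
rewrite /aff (addrACA a _ a) (addrACA (a + a)) triple0 add0r -!mulmxDl.
rewrite -[0](mul0mx _ M) (inj_eq (can_inj (mulmxK uM))) addr3_eq0 zsumE /third.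
by rewrite -vecD -vecN (inj_eq (can_inj vecK)).
Qed.

Definition aff_chart := Chart affK affVK aff_sum.

End AffineChart.

Lemma pt_opp_neq (v : pt) : v != 0 -> v != - v.
Proof.
apply: contra_neq => e; have := triple0 v.
by rewrite {1}e addNr add0r.
Qed.

(** Induction on [n], removing a vector and its opposite; these differ because [v = -v] would give
    [v = 0] in characteristic 3. *)
Lemma symmetric_pairs n (V : {set pt}) : 0 \notin V -> {in V, forall v, - v \in V} ->
    #|V| = n.*2 ->
  exists s : seq pt, [/\ size s = n, uniq (s ++ map -%R s) & V =i s ++ map -%R s].
Proof.
elim: n V => [|n IHn] V V0 VN cardV.
  by exists [::]; split=> // v; rewrite (cards0_eq cardV) inE.
have /card_gt0P[v Vv] : (0 < #|V|)%N by rewrite cardV.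
have v0 : v != 0 by apply: contraNneq V0 => <-.
have [|w||s [szs us Vs]] := IHn (V :\ v :\ - v).
- by rewrite !inE (negPf V0) !andbF.
- by rewrite !inE !eqr_opp (eqr_oppLR w) => /and3P[-> -> /VN->].
- move: cardV; rewrite (cardsD1 v) Vv (cardsD1 (- v)) !inE VN // andbT.
  by rewrite eq_sym pt_opp_neq // !add1n doubleS => -[].
have mem_s w : (w \in s ++ map -%R s) = [&& w != - v, w != v & w \in V].
  by rewrite -Vs !inE.
exists (v :: s); split; first by rewrite /= szs.
  have pE : perm_eq (v :: - v :: s ++ map -%R s) ((v :: s) ++ map -%R (v :: s)).
    by rewrite /= perm_cons -cat1s perm_catCA.
  by rewrite -(perm_uniq pE) /= us inE negb_or pt_opp_neq // !mem_s !eqxx !andbF.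
move=> w; rewrite /= inE mem_cat inE.
have := mem_s w; rewrite mem_cat.
case: (w =P v) => [->|_] /=; first by rewrite Vv.
case: (w =P - v) => [->|_] /= e; first by rewrite VN ?orbT.
by rewrite -e.
Qed.

Definition dot (f v : pt) : 'F_3 := \sum_(i < 4) f 0 i * v 0 i.

Lemma dotE f v : dot f v = (f *m v^T) 0 0.
Proof. by rewrite mxE; apply: eq_bigr => i _; rewrite mxE. Qed.

Lemma dotDr f u v : dot f (u + v) = dot f u + dot f v.
Proof. by rewrite !dotE linearD /= mulmxDr mxE. Qed.

Lemma dotNr f v : dot f (- v) = - dot f v.
Proof. by rewrite !dotE linearN /= mulmxN mxE. Qed.

(* [s] lists one vector from each of the five opposite pairs of [D - a]. *)
Lemma demicap_vectors a D : demicap_with a D ->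
  exists s : seq pt, [/\ size s = 5%N, uniq s,
    forall v, (a + v \in D) = (v \in s ++ map -%R s)
    & forall (f : pt) (t : seq pt), f != 0 -> uniq t -> size t = 4%N ->
        {subset t <= s} -> exists2 v, v \in t & dot f v != 0].
Proof.
case=> capD /andP[aD /forall_inP ancD] cardD genD.
pose V := [set v | a + v \in D].
have V0 : 0 \notin V by rewrite inE addr0.
have VN : {in V, forall v, - v \in V}.
  move=> v; rewrite !inE => /ancD/exists_inP[y Dy].
  rewrite is_lineE => /andP[_ /eqP yE].
  (* The partner of [a + v] is [-(a + (a + v))], which is [a - v] as [3a = 0]. *)
  suff -> : a - v = y by [].
  by apply/eqP; rewrite yE -subr_eq0 opprK (addrC a v) (addrCA a v) !addrA subrK triple0.
have cardV : #|V| = 5%N.*2.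
  rewrite -[RHS]/10%N -cardD -(card_imset (mem V) (addrI a)); apply: eq_card => x.
  apply/imsetP/idP=> [[v]|Dx]; first by rewrite inE => Dv ->.
  by exists (x - a); rewrite ?inE addrC subrK.
have [s [szs us Vs]] := symmetric_pairs V0 VN cardV.
exists s; split=> // [|v|f t f0 ut szt ts].
- by move: us; rewrite cat_uniq => /andP[].
- by rewrite -Vs inE.
(* If [f] vanished on the four vectors, their four [a]-lines would lie in the hyperplane where [f]
   takes its value at [a], against the demicap condition. *)
apply/hasP; apply: contraT => /hasPn dot0.
have uN : uniq (t ++ map -%R t).
  move: us; rewrite !cat_uniq !(map_inj_uniq oppr_inj) ut andbT => /and3P[_ + _].
  apply: contra => /hasP[v /mapP[w tw ->] tv]; apply/hasP.
  by exists (- w); [apply: map_f; apply: ts | apply: ts].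
pose St := [set x : pt | x - a \in t ++ map -%R t].
have StD : St \subset D.
  apply/subsetP=> x; rewrite inE => xt; rewrite -[x](subrK a) addrC.
  have: x - a \in V.
    rewrite Vs; move: xt; rewrite !mem_cat => /orP[/ts->//|/mapP[w tw ->]].
    by rewrite map_f ?orbT // ts.
  by rewrite inE.
have cardSt : #|St| = 8%N.
  have -> : 8%N = size (t ++ map -%R t) by rewrite size_cat size_map szt.
  rewrite -(card_uniqP uN) -(card_imset (mem (t ++ map -%R t)) (addrI a)).
  apply: eq_card => x; apply/idP/imsetP=> [|[v tv ->]]; rewrite inE; last by rewrite addrC addKr.
  by move=> xt; exists (x - a); rewrite // addrC subrK.
have ancSt : anchor a St.
  apply/andP; split; first by apply: contra aD; apply: (subsetP StD).
  apply/forall_inP=> x Sx; apply/exists_inP; exists (- (a + x)).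
    rewrite inE; have -> : - (a + x) - a = - (x - a).
      by rewrite -opprD -[x - a]addr0 -(triple0 a) !addrA subrK (addrC a x).
    move: Sx; rewrite inE !mem_cat => /orP[tx|/mapP[w tw ->]].
      by rewrite map_f ?orbT.
    by rewrite opprK tw.
  rewrite is_lineE eqxx andbT; apply: contraNneq aD => ->; exact: (subsetP StD).
case: (genD _ StD ancSt cardSt).
exists [set x : pt | \sum_(i < 4) f 0 i * x 0 i == dot f a]; split.
  by exists f, (dot f a).
apply/subsetP=> x; rewrite !inE => xt; rewrite -/(dot f x).
rewrite -[x](subrK a) dotDr -subr_eq0 addrK.
move: xt; rewrite mem_cat => /orP[/dot0|/mapP[w /dot0 + ->]].
  by rewrite negbK.
by rewrite negbK dotNr oppr_eq0.
Qed.

(** Four of the five vectors form a basis, and the fifth is a combination of them with all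
    coefficients nonzero, hence equal to 1 or -1. Absorbing these signs into the basis turns the
    fifth vector into (1,1,1,1); the sign changes are harmless because [D] is symmetric about
    [a]. *)
Lemma demicap_chart D : demicap D -> exists c, D = img c frame.
Proof.
case=> a dD; have [s [szs us Ds gen]] := demicap_vectors dD.
have [_ _ cardD _] := dD.
pose v i := nth 0 s i.
pose M : 'M['F_3]_4 := \matrix_(i < 4) v i.
have vs i : (i < 5)%N -> v i \in s by move=> lti; rewrite mem_nth ?szs.
have rowM f (i : 'I_4) : (f *m M^T) 0 i = dot f (v i).
  by rewrite mxE; apply: eq_bigr => j _; rewrite !mxE.
(* A kernel vector of the transpose would be a functional vanishing on the first four vectors. *)
have uM : M \in unitmx.
  rewrite -unitmx_tr unitmxE unitfE; apply/det0P=> -[f f0 fM].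
  have [||w|w tw] := gen f (take 4 s) f0.
  - exact: take_uniq.
  - by rewrite size_take szs.
  - exact: mem_take.
  have lt_i : (index w (take 4 s) < 4)%N.
    by rewrite -[X in (_ < X)%N](_ : size (take 4 s) = 4%N) ?index_mem // size_take szs.
  have := rowM f (Ordinal lt_i); rewrite fM mxE /v /= -(@nth_take 4%N _ _ _ lt_i) nth_index //.
  by move<-; rewrite eqxx.
pose lam := v 4 *m invmx M.
have lamM : lam *m M = v 4 by rewrite mulmxKV.
have lam0 i : lam 0 i != 0.
  (* [f] is the dual basis vector of [v i]; if [lam 0 i = 0], it vanishes on the four vectors of [s]
     other than [v i]. *)
  apply/eqP=> lami; pose f : pt := (col i (invmx M))^T.
  have dotf w : dot f w = (w *m invmx M) 0 i.
    by rewrite !mxE; apply: eq_bigr => j _; rewrite !mxE mulrC.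
  have dotv (j : 'I_4) : dot f (v j) = (j == i)%:R.
    have -> : v j = row j M by apply/rowP=> k; rewrite !mxE.
    by rewrite dotf -row_mul mulmxV // !mxE.
  have f0 : f != 0.
    apply: contra_eq_neq (dotv i) => ->.
    by rewrite eqxx dotE mul0mx mxE eq_sym oner_neq0.
  have ltn45 : (i < 5)%N by rewrite ltnS ltnW.
  have [||w|w] := gen f (rem (v i) s) f0.
  - exact: rem_uniq.
  - by rewrite size_rem ?szs // vs.
  - exact: mem_rem.
  rewrite mem_rem_uniq // inE => /andP[nwi sw].
  have lt_k : (index w s < 5)%N by rewrite -szs index_mem.
  have wE : w = v (index w s) by rewrite /v nth_index.
  rewrite wE; case: (ltngtP (index w s) 4%N) => [lt4||e4].
  - have /negPf ni : Ordinal lt4 != i.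
      by apply: contraNneq nwi => <-; apply/eqP.
    by rewrite (dotv (Ordinal lt4)) ni eqxx.
  - by rewrite ltnNge -ltnS lt_k.
  by rewrite e4 dotf -/lam lami eqxx.
(* The rows of [L] are the vectors [lam_i v_i], whose sum is the fifth vector. *)
pose L := diag_mx lam *m M.
have uL : L \in unitmx.
  rewrite unitmx_mul uM andbT unitmxE unitfE det_diag.
  by apply/prodf_neq0=> i _; apply: lam0.
have lamP (i : 'I_4) : lam 0 i = 1 \/ lam 0 i = - 1.
  case: (lam 0 i) (lam0 i) => [[|[|[|[]]]]] // H _; [left|right]; exact: val_inj.
exists (aff_chart a uL); apply/eqP; rewrite eq_sym eqEcard cardD card_img // andbT.
apply/subsetP=> x; rewrite -[x](chK (aff_chart a uL)); move: (ch _ x) => {x} t.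
rewrite mem_img Ds.
have neg_s u : u \in s ++ map -%R s -> - u \in s ++ map -%R s.
  rewrite !mem_cat => /orP[su|/mapP[w sw ->]]; first by rewrite map_f ?orbT.
  by rewrite opprK sw.
have unit_vec (i : 'I_4) u : vec u = delta_mx 0 i ->
    vec u *m L \in s ++ map -%R s.
  move=> ->; rewrite -rowE row_mul row_diag_mx -scalemxAl -rowE.
  have -> : row i M = v i by apply/rowP=> j; rewrite !mxE.
  have si : v i \in s ++ map -%R s by rewrite mem_cat vs // ltnS ltnW.
  by case: (lamP i) => ->; rewrite ?scale1r ?scaleN1r // neg_s.
have base u : u \in [:: Code t1 t0 t0 t0; Code t0 t1 t0 t0; Code t0 t0 t1 t0;
               Code t0 t0 t0 t1; Code t1 t1 t1 t1] -> vec u *m L \in s ++ map -%R s.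
  rewrite !inE => /or4P[/eqP->|/eqP->|/eqP->|/orP[]/eqP->].
  - by apply: (unit_vec 0); apply/rowP=> -[[|[|[|[|[]]]]]] // H; rewrite !mxE.
  - by apply: (unit_vec 1); apply/rowP=> -[[|[|[|[|[]]]]]] // H; rewrite !mxE.
  - by apply: (unit_vec 2); apply/rowP=> -[[|[|[|[|[]]]]]] // H; rewrite !mxE.
  - by apply: (unit_vec 3); apply/rowP=> -[[|[|[|[|[]]]]]] // H; rewrite !mxE.
  have -> : vec (Code t1 t1 t1 t1) = const_mx 1.
    by apply/rowP=> -[[|[|[|[|[]]]]]] // H; rewrite !mxE.
  have e1 : const_mx 1 *m diag_mx lam = lam.
    by rewrite mul_mx_diag; apply/rowP=> i; rewrite !mxE mul1r.
  by rewrite mulmxA e1 lamM mem_cat vs.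
rewrite /frame mem_cat => /orP[/base //|/mapP[u /base + ->]].
by rewrite vecN mulNmx; apply: neg_s.
Qed.

End FrameCharts.

(* The 3-cycle of [e1, e2, e3] combined with the exchange of [e4] and
   [-(e1 + e2 + e3 + e4)]. *)
Definition rot (x : code) : code :=
  let: Code a b c d := x in
  Code (tadd c (topp d)) (tadd a (topp d)) (tadd b (topp d)) (topp d).

Definition rotV (x : code) : code :=
  let: Code a b c d := x in
  Code (tadd b (topp d)) (tadd c (topp d)) (tadd a (topp d)) (topp d).

Lemma rotK : cancel rot rotV.
Proof.
have e u v : tadd (tadd u (topp v)) (topp (topp v)) = u by case: u v => [] [].
by case=> a b c d; rewrite /= !e; case: d.
Qed.

Lemma rotVK : cancel rotV rot.
Proof.
have e u v : tadd (tadd u (topp v)) (topp (topp v)) = u by case: u v => [] [].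
by case=> a b c d; rewrite /= !e; case: d.
Qed.

Lemma rot_third x y : rot (third x y) = third (rot x) (rot y).
Proof.
have e u v u' v' : tadd (topp (tadd u u')) (topp (topp (tadd v v')))
    = topp (tadd (tadd u (topp v)) (tadd u' (topp v'))).
  by case: u v u' v' => [] [] [] [].
have e' v v' : topp (topp (tadd v v')) = topp (tadd (topp v) (topp v')).
  by case: v v' => [] [].
by case: x y => a b c d [a' b' c' d']; rewrite /third /= !e e'.
Qed.

(** * The symmetry permuting the complements of the frame *)

Section Rotation.

Variable c : chart.

Lemma rot_chart_sum x y z :
  ((cg c (rot x) + cg c (rot y) + cg c (rot z))%R == 0%R) = zsum x y z.
Proof. by rewrite cg_sum !zsumE -rot_third (inj_eq (can_inj rotK)). Qed.

Definition rot_chart : chart :=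
  Chart (can_comp (cgK c) rotK) (can_comp rotVK (chK c)) rot_chart_sum.

Lemma img_rot l : img rot_chart l = img c (map rot l).
Proof.
apply/setP=> x; rewrite !inE /= -{2}[ch c x]rotVK mem_map //.
exact: can_inj rotK.
Qed.

End Rotation.

Lemma img_rot_iter k c l :
  img (iter k rot_chart c) l = img c (iter k (map rot) l).
Proof. by elim: k l => // k IHk l; rewrite iterS img_rot IHk -iterSr. Qed.

Lemma rot_frame : perm_eq (map rot frame) frame. Proof. by vm_compute. Qed.

Lemma img_rot_frame k c : img (iter k rot_chart c) frame = img c frame.
Proof.
elim: k => // k IHk; rewrite iterS img_rot -IHk.
exact/img_eq/perm_mem/rot_frame.
Qed.

(** The six complements of [frame] form a single orbit under [rot]. *)
Lemma rests_frame_rot : all (fun r =>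
  has (fun k => perm_eq (iter k (map rot) frame') r) (iota 0 6)) (rests frame frame_caps).
Proof. by vm_compute. Qed.

(** Composing the chart with a power of [rot] keeps the image of [frame] and carries [frame'] to the
    prescribed complement. *)
Lemma align_chart c r : r \in rests frame frame_caps ->
  exists c', img c' frame = img c frame /\ img c' frame' = img c r.
Proof.
move=> /(allP rests_frame_rot)/hasP[k _ pr]; exists (iter k rot_chart c).
by split; [exact: img_rot_frame | rewrite img_rot_iter; apply/img_eq/perm_mem].
Qed.

(** * The claims in standard position *)

Lemma imset2_set_seq (aT rT sT : finType) (f : aT -> rT -> sT) (s : seq aT) (t : seq rT) :
  [set f x y | x in [set:: s], y in [set:: t]] = [set:: [seq f x y | x <- s, y <- t]].
Proof.
apply/setP=> z; rewrite inE; apply/imset2P/allpairsP => [[x y]|[[x y] /= [sx ty ->]]].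
  by rewrite !inE => sx ty ->; exists (x, y).
by exists x y; rewrite ?inE.
Qed.

Section StandardPosition.

Variable c : chart.
Local Notation S := (img c).
Hypothesis maxcapE : forall K, maxcap K = cap K && (#|K| == 20).

Lemma maxcaps_frame :
  [set K : {set pt} | maxcap K && (S frame \subset K)] = [set:: map S frame_caps].
Proof. by apply: (maxcaps_over c maxcapE frame_capsE); vm_compute. Qed.

Lemma maxcaps_frame' :
  [set K : {set pt} | maxcap K && (S frame' \subset K)] = [set:: map S frame'_caps].
Proof. by apply: (maxcaps_over c maxcapE frame'_capsE); vm_compute. Qed.

Lemma card_extensions D L : extensions D = L -> uniq L -> #|[set:: map S L]| = size L.
Proof.
move=> EL uL; apply: img_seq_card => // l Ll.
by apply: (@extensions_nf D); rewrite EL.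
Qed.

Lemma diff_rests D L :
  [set K :\: S D | K in [set:: map S L]] = [set:: map S (rests D L)].
Proof.
rewrite imset_set_seq /rests -!map_comp.
have e : (fun K => K :\: S D) \o S =1 S \o filter (fun x => ~~ memc x D).
  by move=> l; rewrite /= img_diff.
by rewrite (eq_map e).
Qed.

Lemma img_products :
  [set R :|: D | R in [set:: map S (rests frame frame_caps)],
                 D in [set:: map S (rests frame' frame'_caps)]]
  = [set:: map S products].
Proof.
have e r d : S r :|: S d = S (nf (r ++ d)) by rewrite img_nf img_cat.
rewrite imset2_set_seq allpairs_mapl allpairs_mapr -productsE map_allpairs.
by rewrite (eq_allpairs _ _ e).
Qed.

Lemma standard_position :
  let C := S phi_cap in let C1 := S frame in let R1 := S frame' in
  let Rs := [set K :\: C1 | K in [set K : {set pt} | maxcap K && (C1 \subset K)]] in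
  let Cs := [set K :\: R1 | K in [set K : {set pt} | maxcap K && (R1 \subset K)]] in
  [/\ #|[set K : {set pt} | maxcap K && (C1 \subset K)]| = 6,
      #|[set K : {set pt} | maxcap K && (R1 \subset K)]| = 6,
      (forall R D, R \in Rs -> D \in Cs -> maxcap (R :|: D)),
      [set R :|: D | R in Rs, D in Cs] = [set K | completable 1 C K] &
      #|[set R :|: D | R in Rs, D in Cs]| = 36].
Proof.
move=> C C1 R1 Rs Cs.
have prodE : [set R :|: D | R in Rs, D in Cs] = [set K | completable 1 C K].
  rewrite /Rs /Cs maxcaps_frame maxcaps_frame' !diff_rests img_products.
  by apply/setP=> K; rewrite in_set [RHS]in_set (completable1 c maxcapE).
split=> //.
- by rewrite maxcaps_frame (card_extensions frame_capsE); last by vm_compute.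
- by rewrite maxcaps_frame' (card_extensions frame'_capsE); last by vm_compute.
- move=> R D RsR CsD; have : R :|: D \in [set R :|: D | R in Rs, D in Cs].
    exact: imset2_f.
  by rewrite prodE inE => /and4P[].
rewrite prodE; have -> : [set K | completable 1 C K] = [set:: map S products].
  by apply/setP=> K; rewrite in_set [RHS]in_set (completable1 c maxcapE).
rewrite (@img_seq_card c products); first by vm_compute.
  by vm_compute.
move=> l; rewrite -productsE => /allpairsP[rd [_ _ ->]]; exact: nf_nf.
Qed.

End StandardPosition.

(** * Moving a given decomposition to standard position *)

Lemma frames_centred : centred (frame ++ frame'). Proof. by vm_compute. Qed.

Theorem theorem5p1 (C C' C1 R1 : {set pt}) (a : pt) :
  completable 1 C C' ->
  anchor a C' ->
  C' = C1 :|: R1 -> [disjoint C1 & R1] ->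
  demicap C1 -> demicap R1 ->
  Phi a C1 R1 = C ->
  let Rs := [set K :\: C1 | K in [set K : {set pt} | maxcap K && (C1 \subset K)]] in
  let Cs := [set K :\: R1 | K in [set K : {set pt} | maxcap K && (R1 \subset K)]] in
  [/\ #|[set K : {set pt} | maxcap K && (C1 \subset K)]| = 6%N,
      #|[set K : {set pt} | maxcap K && (R1 \subset K)]| = 6%N,
      (forall R D, R \in Rs -> D \in Cs -> maxcap (R :|: D)),
      [set R :|: D | R in Rs, D in Cs] = [set K | completable 1 C K] &
      #|[set R :|: D | R in Rs, D in Cs]| = 36%N].
Proof.
case/and4P=> _ maxC' _ _ ancC' C'E disCR dC1 dR1 PhiE.
have cardC' : #|C'| = 20.
  have [[? [_ _ cardC1 _]] [? [_ _ cardR1 _]]] := (dC1, dR1).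
  by rewrite C'E cardsU (disjoint_setI0 disCR) cards0 cardC1 cardR1.
have maxcapE K : maxcap K = cap K && (#|K| == 20).
  by rewrite (maxcap_card _ maxC') cardC'.
have [c0 C1E] := demicap_chart dC1.
(* [C'] is itself a maximal cap over [C1], so its complement [R1] is one of the six listed. *)
have [r rr R1E] : exists2 r, r \in rests frame frame_caps & R1 = img c0 r.
  have : C' \in [set K : {set pt} | maxcap K && (C1 \subset K)].
    by rewrite inE maxC' C'E subsetUl.
  rewrite C1E maxcaps_frame // inE => /mapP[K capsK C'K].
  exists [seq x <- K | ~~ memc x frame]; first exact: map_f.
  rewrite -img_diff -C'K -C1E C'E setDUl setDv set0U.
  by apply/esym/setDidPl; rewrite disjoint_sym.
have [c [cC1 cR1]] := align_chart c0 rr.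
rewrite -R1E in cR1; rewrite -C1E in cC1.
(* In the chart [C'] is [frame ++ frame'], which has no anchor but the origin; hence [Phi] is
   computed by [phi_img]. *)
have aE : a = cg c origin.
  by apply: (anchor_origin frames_centred); rewrite img_cat cC1 cR1 -C'E.
have := @standard_position c maxcapE.
by rewrite -phi_img -aE cC1 cR1 PhiE.
Qed.
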